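(* Let $G$ be a conjugation-free group whose associated graph $Gr(G)$ is a cycle-separated graph. For $i\ge 3$ let $n_i$ be the number of cyclic relations of length $i$ of $G$. Then $$\phi_k(G)=\sum_{i\ge 3} n_i\,\omega_k(i-1)\qquad\text{for every } k\ge 2.$$
   Context: Lower central series: for a group $G$ put $[a,b]=a^{-1}b^{-1}ab$, $G_1=G$, $G_k=[G_{k-1},G]$ for $k\ge2$, and for finitely generated $G$ let $\phi_k(G)=\operatorname{rank}(G_k/G_{k+1})$ be the rank of the finitely generated abelian group $G_k/G_{k+1}$. Let $\omega_k(n)=\phi_k(\mathbb{F}_n)$, where $\mathbb{F}_n$ is the free group of rank $n$. Conjugation-free group: a finitely presented group $G$ is conjugation-free if it has a presentation with generators $x_1,\dots,x_n$ and relations $R_1,\dots,R_w$ such that: (1) each $R_p$ is a (conjugation-free) cyclic relation of some length $t\ge2$, i.e. of the form $$R_{p,(i_t,\dots,i_1)}:\quad x_{i_t}x_{i_{t-1}}\cdots x_{i_1}=x_{i_{t-1}}\cdots x_{i_1}x_{i_t}=\cdots=x_{i_1}x_{i_t}\cdots x_{i_2},$$ where $i_1<i_2<\dots<i_t$ are indices in $\{1,\dots,n\}$ (for $t=2$ this is the commutator relation $[x_{i_1},x_{i_2}]=e$); (2) for every pair $j_1\ne j_2$ in $\{1,\dots,n\}$ there is a unique relation $R_{p,(i_t,\dots,i_1)}$ with $\{j_1,j_2\}\subseteq\{i_1,\dots,i_t\}$; (3) for any two relations $R_{p,(i_t,\dots,i_1)}$, $R_{p',(j_s,\dots,j_1)}$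 with $p\ne p'$, $|\{i_1,\dots,i_t\}\cap\{j_1,\dots,j_s\}|\le1$. Such a presentation is fixed as part of the data; the numbers $n_i$ and the graph $Gr(G)$ are taken with respect to it. Associated graph $Gr(G)$: it has one vertex for each multiple relation, i.e. each cyclic relation of length $t\ge3$; two vertices, corresponding to $R_{p,(i_t,\dots,i_1)}$ and $R_{p',(j_s,\dots,j_1)}$, are joined by an edge if the sets $\{i_1,\dots,i_t\}$ and $\{j_1,\dots,j_s\}$ have exactly one common index. Cycle-separated graph: a planar, simple, connected graph such that every two (distinct) cycles have no vertex in common and all of whose edges are (drawn as) straight segments. *)

(* Defs.v *)
From HB Require Import structures.
From mathcomp Require Import all_boot all_order all_algebra.
From mathcomp Require Import boolp classical_sets reals.

Set Implicit Arguments.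
Unset Strict Implicit.
Unset Printing Implicit Defensive.

Import GRing.Theory.
Local Open Scope group_scope.
Local Open Scope quotient_scope.

(* Possibly infinite groups are MathComp's [groupType] (boot/monoid.v), whose
   commutator is [~ a, b] = a^-1 * b^-1 * a * b. *)

Section LowerCentralSeries.
Variable G : groupType.

Inductive gen_subgroup (S : set G) : G -> Prop :=
| gen_mem x of S x : gen_subgroup S x
| gen_one : gen_subgroup S 1
| gen_mul x y of gen_subgroup S x & gen_subgroup S y : gen_subgroup S (x * y)
| gen_inv x of gen_subgroup S x : gen_subgroup S x^-1.

Definition comm_subgroup (H K : set G) : set G :=
  gen_subgroup (fun x => exists a b, [/\ H a, K b & x = [~ a, b]]).

(* The series is indexed from 1; index 0 is a placeholder for G. *)
Fixpoint lcs (k : nat) : set G :=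
  if k is (k'.+1 as j).+1 then comm_subgroup (lcs j) setT else setT.

Lemma lcs1 k : lcs k 1.
Proof. by case: k => [|[|k]] //=; exact: gen_one. Qed.

Lemma lcsM k x y : lcs k x -> lcs k y -> lcs k (x * y).
Proof. by case: k => [|[|k]] //=; exact: gen_mul. Qed.

Lemma lcsV k x : lcs k x -> lcs k x^-1.
Proof. by case: k => [|[|k]] //=; exact: gen_inv. Qed.

Lemma lcsR k x y : lcs k x -> lcs k.+1 [~ x, y].
Proof. by case: k => [|k] //= Hx; apply: gen_mem; exists x, y. Qed.

Lemma lcsJ k x y : lcs k x -> lcs k (x ^ y).
Proof.
elim: k x y => [|[|k] IHk] // x y.
elim=> {x} [x [u [v [Hu _ ->]]]||x1 x2 _ H1 _ H2|x _ H].
- rewrite conjRg; apply: gen_mem; exists (u ^ y), (v ^ y); split=> //.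
  exact: IHk.
- by rewrite conj1g; exact: gen_one.
- by rewrite conjMg; exact: gen_mul.
- by rewrite conjVg; exact: gen_inv.
Qed.

End LowerCentralSeries.

(* The abelian group G_k / G_(k+1), written additively: a subtype of G
   carrying the group G_k, then its quotient by G_(k+1). *)
Section LcsQuotient.
Variables (G : groupType) (k : nat).

Definition lcs_pred : pred G := fun x => `[< lcs k x >].

Lemma lcs_predP x : reflect (lcs k x) (x \in lcs_pred).
Proof. exact: asboolP. Qed.

Lemma lcs_pred_closed : group_closed lcs_pred.
Proof.
split; first exact/lcs_predP/lcs1.
by move=> x y /lcs_predP Hx /lcs_predP Hy; apply/lcs_predP/lcsM/lcsV.
Qed.

Record lcs_sub := LcsSub { lcs_val :> G; _ : lcs_pred lcs_val }.
HB.instance Definition _ := [isSub for lcs_val].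
HB.instance Definition _ := [Choice of lcs_sub by <:].
HB.instance Definition _ :=
  SubChoice_isSubGroup.Build G lcs_pred lcs_sub lcs_pred_closed.

Lemma lcs_subP (x : lcs_sub) : lcs k (val x).
Proof. by apply/lcs_predP; case: x. Qed.

Definition lcq_rel (x y : lcs_sub) : bool :=
  `[< lcs k.+1 (val (x^-1 * y)) >].

Lemma lcq_rel_refl : reflexive lcq_rel.
Proof. by move=> x; apply/asboolP; rewrite mulVg; exact: lcs1. Qed.

Lemma lcq_rel_imp x y : lcq_rel x y -> lcq_rel y x.
Proof.
move=> /asboolP/lcsV; rewrite -gmulfV invgM invgK => ?; exact/asboolP.
Qed.

Lemma lcq_rel_sym : symmetric lcq_rel.
Proof. by move=> x y; apply/idP/idP; exact: lcq_rel_imp. Qed.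

Lemma lcq_rel_trans : transitive lcq_rel.
Proof.
move=> y x z /asboolP Hxy /asboolP Hyz; apply/asboolP.
have -> : x^-1 * z = (x^-1 * y) * (y^-1 * z) by rewrite mulgA mulgK.
by rewrite gmulfM; exact: lcsM.
Qed.

Canonical lcq_equiv := EquivRel lcq_rel lcq_rel_refl lcq_rel_sym lcq_rel_trans.

Definition lcq := {eq_quot lcq_equiv}.
HB.instance Definition _ := Choice.on lcq.
HB.instance Definition _ := EqQuotient.on lcq.

Definition lcq_zero : lcq := \pi_lcq (1 : lcs_sub).
Definition lcq_opp (x : lcq) : lcq := \pi_lcq ((repr x)^-1 : lcs_sub).
Definition lcq_add (x y : lcq) : lcq := \pi_lcq (repr x * repr y : lcs_sub).

Lemma lcq_eqP (x y : lcs_sub) :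
  reflect (lcs k.+1 (val (x^-1 * y))) (\pi_lcq x == \pi_lcq y).
Proof. by rewrite eqmodE; exact: asboolP. Qed.

Lemma lcq_piV (x : lcs_sub) : lcq_opp (\pi_lcq x) = \pi_lcq (x^-1).
Proof.
apply/eqP/lcq_eqP; case: piP => y /eqP/lcq_eqP H.
rewrite invgK.
have -> : y * x^-1 = (x^-1 * y) ^ (x^-1) by rewrite /conjg invgK mulgA mulVKg.
by rewrite gmulfJ; exact: lcsJ.
Qed.

Lemma lcq_piM (x y : lcs_sub) :
  lcq_add (\pi_lcq x) (\pi_lcq y) = \pi_lcq (x * y).
Proof.
apply/esym/eqP/lcq_eqP; case: piP => x' /eqP/lcq_eqP Hx.
case: piP => y' /eqP/lcq_eqP Hy.
have -> : (x * y)^-1 * (x' * y') = (x^-1 * x') ^ y * (y^-1 * y').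
  by rewrite invgM /conjg !mulgA mulgK.
by rewrite gmulfM gmulfJ; apply: lcsM => //; exact: lcsJ.
Qed.

Lemma lcq_addA : associative lcq_add.
Proof.
move=> x y z; rewrite -[x]reprK -[y]reprK -[z]reprK.
move: (repr x) (repr y) (repr z) => {}x {}y {}z.
by rewrite (lcq_piM y z) (lcq_piM x y) !lcq_piM mulgA.
Qed.

Lemma lcq_addC : commutative lcq_add.
Proof.
move=> x y; rewrite -[x]reprK -[y]reprK.
move: (repr x) (repr y) => {}x {}y.
rewrite (lcq_piM x y) (lcq_piM y x); apply/eqP/lcq_eqP.
have -> : (x * y)^-1 * (y * x) = [~ y, x] by rewrite invgM /commg /conjg !mulgA.
by rewrite gmulfR; apply: lcsR; exact: lcs_subP.
Qed.

Lemma lcq_add0 : left_id lcq_zero lcq_add.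
Proof. by move=> x; rewrite -[x]reprK lcq_piM mul1g. Qed.

Lemma lcq_addN : left_inverse lcq_zero lcq_opp lcq_add.
Proof. by move=> x; rewrite -[x]reprK lcq_piV lcq_piM mulVg. Qed.

HB.instance Definition _ :=
  GRing.isZmodule.Build lcq lcq_addA lcq_addC lcq_add0 lcq_addN.
End LcsQuotient.

Definition independent (A : zmodType) (r : nat) (x : 'I_r -> A) : Prop :=
  forall c : 'I_r -> int,
    (\sum_(i < r) x i *~ c i)%R = 0%R -> forall i, c i = 0%R.

(* Largest size of a Z-independent family; the default value 0 is only used
   when there are arbitrarily large independent families, which does not
   happen for finitely generated A. *)
Definition rank (A : zmodType) : nat :=
  xget 0%N (fun r => (exists x : 'I_r -> A, independent x) /\
    (forall s (y : 'I_s -> A), independent y -> (s <= r)%N)).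

Definition phi (G : groupType) (k : nat) : nat := rank (lcq G k).

(* A letter (i, true) stands for the generator x_i, (i, false) for x_i^-1. *)
Definition letter (n : nat) := ('I_n * bool)%type.
Definition word (n : nat) := seq (letter n).

Section Presented.
Variables (n : nat) (rels : word n -> word n -> Prop).

Inductive word_cong : word n -> word n -> Prop :=
| wc_rel u v of rels u v : word_cong u v
| wc_cancel i b : word_cong [:: (i, b); (i, ~~ b)] [::]
| wc_refl u : word_cong u u
| wc_sym u v of word_cong u v : word_cong v u
| wc_trans u v w of word_cong u v & word_cong v w : word_cong u w
| wc_cat u u' v v' of word_cong u u' & word_cong v v' :
    word_cong (u ++ v) (u' ++ v').

Definition word_congb (u v : word n) : bool := `[< word_cong u v >].

Lemma word_congb_refl : reflexive word_congb.
Proof. by move=> u; apply/asboolP/wc_refl. Qed.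

Lemma word_congb_sym : symmetric word_congb.
Proof. by move=> u v; apply/asboolP/asboolP; exact: wc_sym. Qed.

Lemma word_congb_trans : transitive word_congb.
Proof. by move=> v u w /asboolP H /asboolP H'; apply/asboolP/(wc_trans H). Qed.

Canonical word_equiv :=
  EquivRel word_congb word_congb_refl word_congb_sym word_congb_trans.

(* The group < x_0, ..., x_(n-1) | rels >. *)
Definition presented := {eq_quot word_equiv}.
HB.instance Definition _ := Choice.on presented.
HB.instance Definition _ := EqQuotient.on presented.

Definition word_inv (u : word n) : word n := rev [seq (l.1, ~~ l.2) | l <- u].

Definition presented_one : presented := \pi_presented [::].
Definition presented_mul (x y : presented) : presented :=
  \pi_presented (repr x ++ repr y).
Definition presented_inv (x : presented) : presented :=
  \pi_presented (word_inv (repr x)).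

Lemma presented_eqP (u v : word n) :
  reflect (word_cong u v) (\pi_presented u == \pi_presented v).
Proof. by rewrite eqmodE; exact: asboolP. Qed.

Lemma presented_piM (u v : word n) :
  presented_mul (\pi_presented u) (\pi_presented v) = \pi_presented (u ++ v).
Proof.
apply/esym/eqP/presented_eqP; case: piP => u' /eqP/presented_eqP Hu.
by case: piP => v' /eqP/presented_eqP Hv; exact: wc_cat.
Qed.

Lemma word_invV (u : word n) : word_cong (word_inv u ++ u) [::].
Proof.
elim: u => [|[i b] u IHu]; first exact: wc_refl.
rewrite /word_inv /= rev_cons -/(word_inv u) cat_rcons.
apply: wc_trans IHu; apply: wc_cat; first exact: wc_refl.
rewrite -[X in word_cong _ X]cat0s -[_ :: _]/([:: (i, ~~ b); (i, b)] ++ u).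
apply: wc_cat; last exact: wc_refl.
by rewrite -{2}[b]negbK; exact: wc_cancel.
Qed.

Lemma word_invK : involutive word_inv.
Proof.
move=> u; rewrite /word_inv map_rev revK -map_comp -[RHS]map_id.
by apply: eq_map => -[i b] /=; rewrite negbK.
Qed.

Lemma presented_mulA : associative presented_mul.
Proof.
move=> x y z; rewrite -[x]reprK -[y]reprK -[z]reprK.
move: (repr x) (repr y) (repr z) => {}x {}y {}z.
by rewrite (presented_piM y z) (presented_piM x y) !presented_piM catA.
Qed.

Lemma presented_mul1 : left_id presented_one presented_mul.
Proof. by move=> x; rewrite -[x]reprK presented_piM. Qed.

Lemma presented_mulr1 : right_id presented_one presented_mul.
Proof. by move=> x; rewrite -[x]reprK presented_piM cats0. Qed.

Lemma presented_mulV : left_inverse presented_one presented_inv presented_mul.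
Proof.
move=> x; rewrite -{2}[x]reprK presented_piM.
exact/eqP/presented_eqP/word_invV.
Qed.

Lemma presented_mulrV : right_inverse presented_one presented_inv presented_mul.
Proof.
move=> x; rewrite -{1}[x]reprK presented_piM; apply/eqP/presented_eqP.
by rewrite -{1}[repr x]word_invK; exact: word_invV.
Qed.

HB.instance Definition _ := isGroup.Build presented presented_mulA
  presented_mul1 presented_mulr1 presented_mulV presented_mulrV.
End Presented.

Definition free_group (n : nat) : groupType :=
  presented (fun _ _ : word n => False).

Definition omega (k n : nat) : nat := phi (free_group n) k.

(* For idx = [:: i_1; ...; i_t], the t words x_(i_t) ... x_(i_1) and its cyclic
   rotations x_(i_(t-1)) ... x_(i_1) x_(i_t), ..., x_(i_1) x_(i_t) ... x_(i_2)
   are all equal. *)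
Definition cyclic_rel (n : nat) (idx : seq 'I_n) (u v : word n) : Prop :=
  let w := [seq (i, true) | i <- rev idx] in
  u = w /\ exists2 j, (j < size idx)%N & v = rot j w.

Record cf_presentation (G : groupType) := CFPresentation {
  cf_gens : nat;
  cf_rels : nat;
  cf_idx : 'I_cf_rels -> seq 'I_cf_gens;
  cf_size : forall p, (2 <= size (cf_idx p))%N;
  cf_sorted : forall p, sorted (fun i j : 'I_cf_gens => i < j)%N (cf_idx p);
  cf_pair : forall j1 j2 : 'I_cf_gens, j1 != j2 ->
    exists! p, (j1 \in cf_idx p) && (j2 \in cf_idx p);
  cf_meet : forall p q, p != q ->
    (#|[set j | (j \in cf_idx p) && (j \in cf_idx q)]%SET| <= 1)%N;
  cf_iso : exists f : {multiplicative
      presented (fun u v => exists p, cyclic_rel (cf_idx p) u v) -> G},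
    bijective f
}.

Arguments cf_idx {G} _ _.

Section ConjugationFree.
Variables (G : groupType) (P : cf_presentation G).

(* cf_count P i = 0 for i > cf_gens P, the indices being strictly increasing. *)
Definition cf_count (i : nat) : nat := #|[set p | size (cf_idx P p) == i]%SET|.

Definition gr_vertex := {p : 'I_(cf_rels P) | (3 <= size (cf_idx P p))%N}.

Definition gr_edge : rel gr_vertex := fun p q => (p != q) &&
  (#|[set j | (j \in cf_idx P (val p)) && (j \in cf_idx P (val q))]%SET| == 1%N).
End ConjugationFree.

Section CycleSeparated.
Variables (R : realType) (T : finType) (e : rel T).
Local Open Scope ring_scope.

Definition simple_graph : Prop := symmetric e /\ irreflexive e.

(* The empty graph counts as connected. *)
Definition connected_graph : Prop := forall x y : T, connect e x y.

Definition graph_cycle (c : seq T) : Prop := (3 <= size c)%N /\ ucycle e c.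

(* Two closed walks describe the same cycle, up to starting point and
   direction, when they have the same edges. *)
Definition cycle_edges (c : seq T) : {set {set T}} :=
  [set [set x; next c x] | x in c]%SET.

Definition cycles_disjoint : Prop := forall c d,
  graph_cycle c -> graph_cycle d -> cycle_edges c != cycle_edges d ->
  [disjoint c & d].

Definition segment (a b : 'rV[R]_2) : set 'rV[R]_2 :=
  fun z => exists2 t : R, 0 <= t <= 1 & z = (1 - t) *: a + t *: b.

Definition straight_drawing (pos : T -> 'rV[R]_2) : Prop :=
  [/\ injective pos,
      (forall x y z, e x y -> segment (pos x) (pos y) (pos z) ->
         z \in [set x; y]%SET)
    & (forall x y u v z, e x y -> e u v -> [set x; y]%SET != [set u; v]%SET ->
         segment (pos x) (pos y) z -> segment (pos u) (pos v) z ->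
         exists2 s, s \in ([set x; y] :&: [set u; v])%SET & z = pos s)].

Definition cycle_separated : Prop :=
  [/\ simple_graph, connected_graph, cycles_disjoint
    & exists pos, straight_drawing pos].
End CycleSeparated.

(* Main.v *)
From HB Require Import structures.
Require Import Defs.
From mathcomp Require Import all_boot all_order all_algebra.
From mathcomp Require Import boolp classical_sets reals.

(** Call block the index set of a multiple relation. For a block B write G_B for
    the subgroup of G generated by the x_i with i in B, and x_B for the product
    of these generators, in the order of the relation.

    Killing the generators outside B, and one generator of B through the
    equation x_B = 1, respects all relations, because any other relation meets
    B in at most one index. This retracts G onto a free group F_B of rank
    |B| - 1, embedded in G as the subgroup generated by the remaining elements
    of B. Two blocks share at most one generator, so F_B -> G -> F_C has abelian
    image for B <> C. Hence, for k >= 2, the direct sum of the k-th lower central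
    quotients of the F_B is a direct summand of the one of G
    ([block_free_retraction]).

    The content of the theorem is that there is nothing else: for k >= 2 the
    subgroup G_k is generated by the (G_B)_k ([lcs_blocks]). The cyclic relation
    says that x_B is central in G_B, and it expresses each generator of B as the
    product of x_B with an element of the subgroup generated by the others. So
    any one generator may be left out of B without changing the lower central
    series of G_B from its second term on ([sub_lcs_block_punctured]).

    The decisive fact is that a generator x_c with c outside B centralizes the
    derived subgroup of G_B, in G itself and not only up to higher commutators
    ([outside_commute_derived]). Let A be the set of the i in B that lie in a
    common block with c. If A has at most one element, leave it out of B: x_c
    commutes with everything that remains. If A contains i <> j, then B, the
    block C through i and c, and the block D through j and c form a triangle of
    the graph. As cycles are pairwise disjoint, this triangle shares no vertex
    with another one, so for l in B other than i, j and for m in D other than j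
    no block contains both l and m, and x_l commutes with x_m. Leave out i from B,
    and write x_j = y x_D with y in the subgroup K generated by the x_m. Then
    x_D and the x_l centralize K, so B without i generates a subgroup of Z <y>,
    where Z is the centralizer of K and y is in K. Commutators of such products
    lie in Z, hence commute with x_c, which is in K.

    It follows that the (G_B)_k are normal in G and that each generator of G is
    central modulo the terms of index k + 1, which gives [lcs_blocks] by
    induction on k. It remains to add ranks: [rank] is additive on direct sums
    of finitely generated groups ([rank_direct_sum]), and the lower central
    quotients of a finitely generated group are finitely generated
    ([lcq_zspans]). *)

Set Implicit Arguments.
Unset Strict Implicit.
Unset Printing Implicit Defensive.

(** * Ranks of abelian groups *)

Section Rank.
Import GRing.Theory Num.Theory.
Local Open Scope ring_scope.

Definition zindep (A : zmodType) (I : finType) (x : I -> A) : Prop :=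
  forall c : I -> int, \sum_i x i *~ c i = 0 -> forall i, c i = 0.

(** Spanning up to multiples: the span then has the same rank as [A], even when
    [A] has torsion. *)
Definition zspans (A : zmodType) (I : finType) (x : I -> A) : Prop :=
  forall a, exists2 m : int, m != 0 & exists c, a *~ m = \sum_i x i *~ c i.

Lemma clear_denominators (I : finType) (v : I -> rat) :
  exists2 d : int, d != 0 & exists w : I -> int, forall i, v i * d%:~R = (w i)%:~R.
Proof.
exists (\prod_i denq (v i)); first by apply/prodf_neq0 => i _; exact: denq_neq0.
exists (fun i => numq (v i) * \prod_(j | j != i) denq (v j)) => i.
rewrite (bigD1 i) //= !rmorphM /= mulrA; congr (_ * _).
by rewrite -{1}[v i]divq_num_den mulfVK // intr_eq0 denq_neq0.
Qed.

Lemma int_left_kernel (I J : finType) (C : J -> I -> int) : (#|I| < #|J|)%N ->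
  exists2 w : J -> int, (exists j, w j != 0) & forall i, \sum_j w j * C j i = 0.
Proof.
move=> ltIJ.
pose M := (\matrix_(j < #|J|, i < #|I|) (C (enum_val j) (enum_val i))%:~R : 'M[rat]__).
have /rowV0Pn [v /sub_kermxP vM v0] : kermx M != 0.
  by rewrite kermx_eq0 /row_free neq_ltn (leq_ltn_trans (rank_leq_col M)).
have [d d0 [w vw]] := clear_denominators (fun j => v 0 (enum_rank j)).
exists w.
  case/rV0Pn: v0 => j vj; exists (enum_val j).
  rewrite -(intr_eq0 rat) -vw enum_valK mulf_neq0 //.
  by rewrite intr_eq0.
move=> i; apply: (@intr_inj rat); rewrite raddf_sum /=.
transitivity ((v *m M) 0 (enum_rank i) * d%:~R); last by rewrite vM mxE mul0r.
rewrite mxE mulr_suml (reindex_onto (@enum_val J predT) enum_rank) /=; last first.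
  by move=> j _; rewrite enum_rankK.
apply: eq_big => [j|j _]; first by rewrite enum_valK eqxx.
by rewrite intrM -vw mxE enum_valK enum_rankK mulrAC.
Qed.

(** Steinitz exchange over the integers: write a nonzero multiple of each [y j]
    in terms of [x]; with more rows than columns, the coefficient matrix has a
    nonzero left kernel, which is a relation between the [y j]. *)
Lemma zindep_le_zspans (A : zmodType) (I J : finType) (x : I -> A) (y : J -> A) :
  zspans x -> zindep y -> (#|J| <= #|I|)%N.
Proof.
move=> xs yi; rewrite leqNgt; apply/negP => ltIJ.
have /choice [m /all_and2 [m0 /choice [C mC]]] : forall j, exists m : int,
    m != 0 /\ exists c, y j *~ m = \sum_i x i *~ c i.
  by move=> j; have [m m0 c] := xs (y j); exists m.
have [w [j wj] wC] := int_left_kernel C ltIJ.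
suff /yi/(_ j)/eqP : \sum_j y j *~ (m j * w j) = 0.
  by rewrite mulf_eq0 (negPf (m0 j)) (negPf wj).
under eq_bigr => k _.
  rewrite mulrzA mC mulrz_suml; under eq_bigr do rewrite -mulrzA mulrC.
  over.
rewrite exchange_big big1 //= => i _.
by rewrite -mulrz_sumr wC mulr0z.
Qed.

Lemma rank_eq_card (A : zmodType) (I : finType) (x : I -> A) :
  zindep x -> zspans x -> rank A = #|I|.
Proof.
move=> xi xs; have le_card s (y : 'I_s -> A) : independent y -> (s <= #|I|)%N.
  by move/(zindep_le_zspans xs); rewrite card_ord.
have x'i : independent (x \o @enum_val I predT).
  move=> c /=; rewrite (reindex_onto (@enum_rank I) enum_val) /=; last first.
    by move=> i _; rewrite enum_valK.
  under eq_bigl do rewrite enum_rankK eqxx.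
  under eq_bigr do rewrite enum_rankK.
  by move/xi => c0 i; rewrite -[i]enum_valK c0.
apply: xget_unique => [|r [[y yi] ymax]].
  by split; first by exists (x \o enum_val).
by apply/eqP; rewrite eqn_leq (le_card _ y yi) (ymax _ _ x'i).
Qed.

Lemma sum_option (A : zmodType) (I : finType) (F : option I -> A) :
  \sum_o F o = F None + \sum_i F (Some i).
Proof.
rewrite (bigD1 None) //=; congr (_ + _).
rewrite (reindex_omap Some id) => [|[]//] /=.
by apply: eq_bigl => i; rewrite eqxx.
Qed.

Lemma sum_tagged (A : zmodType) (T : finType) (I : T -> finType)
    (F : {p : T & I p} -> A) :
  \sum_u F u = \sum_p \sum_(i : I p) F (Tagged I i).
Proof. by rewrite sig_big_dep; apply: eq_big => // -[]. Qed.

(** An independent family of maximal size is a basis up to multiples; the bound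
    on its size comes from [zindep_le_zspans]. *)
Lemma exists_zbasis (A : zmodType) (I : finType) (x : I -> A) :
  zspans x -> exists J : finType, exists2 y : J -> A, zindep y & zspans y.
Proof.
move=> xs.
pose P r := `[< exists y : 'I_r -> A, zindep y >].
have P0 : exists r, P r.
  by exists 0%N; apply/asboolP; exists (fun=> 0) => c _ [].
have Pmax r : P r -> (r <= #|I|)%N.
  by case/asboolP => y /(zindep_le_zspans xs); rewrite card_ord.
case: (ex_maxnP P0 Pmax) => r /asboolP [y yi] rmax; exists 'I_r, y => // a.
(* Adjoining [a] to the maximal family [y] must create a relation. *)
pose z (o : option 'I_r) := if o is Some i then y i else a.
have [zi|] := pselect (zindep z).
  suff /rmax : P r.+1 by rewrite ltnn.
  apply/asboolP; exists (z \o unlift ord_max) => c /=.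
  rewrite big_ord_recr /= unlift_none /= => c0.
  have: \sum_o z o *~ (if o is Some i then c (widen_ord (leqnSn r) i) else c ord_max) = 0.
    rewrite -[RHS]c0 addrC sum_option; congr (_ + _).
    apply: eq_bigr => i _.
    suff -> : widen_ord (leqnSn r) i = lift ord_max i by rewrite liftK.
    by apply: val_inj => /=; rewrite /bump leqNgt ltn_ord.
  move/zi => {}c0 i; case: (unliftP ord_max i) => [j ->|->]; last exact: (c0 None).
  have := c0 (Some j) => /= <-; congr c.
  by apply: val_inj => /=; rewrite /bump leqNgt ltn_ord.
move=> /existsNP [c /not_implyP [c0 /existsNP [i /eqP ci]]].
have split0 : a *~ c None + \sum_i y i *~ c (Some i) = 0.
  by rewrite -[RHS]c0 sum_option.
exists (c None).
  apply/eqP => cN; move: split0; rewrite cN mulr0z add0r => /yi ceq.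
  by case: i ci => [i|]; rewrite ?ceq ?cN eqxx.
exists (fun i => - c (Some i)).
move/eqP: split0; rewrite addr_eq0 => /eqP->; rewrite -sumrN.
by apply: eq_bigr => j _; rewrite mulrNz.
Qed.

(** The finiteness hypothesis cannot be dropped: [rank] takes the default value 0
    on groups of infinite rank. *)
Lemma rank_direct_sum (T : finType) (A : zmodType) (B : T -> zmodType)
    (inj : forall p, {additive B p -> A}) (proj : forall p, {additive A -> B p}) :
  (forall p, exists I : finType, exists x : I -> B p, zspans x) ->
  (forall p b, proj p (inj p b) = b) ->
  (forall p q b, p != q -> proj q (inj p b) = 0) ->
  (forall a, exists b : forall p, B p, a = \sum_p inj p (b p)) ->
  rank A = (\sum_p rank (B p))%N.
Proof.
move=> fin injK injN injS.
have basis p : {I : finType & {x : I -> B p | zindep x & zspans x}}.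
  have [J /cid [y ys]] := cid (fin p).
  have [K /cid2 [z zi zs]] := cid (exists_zbasis ys).
  by exists K, z.
pose I p : finType := tag (basis p).
have [x xi xs] : {x : forall p, I p -> B p |
    forall p, zindep (x p) & forall p, zspans (x p)}.
  exists (fun p => s2val (tagged (basis p))) => p.
  - exact: s2valP (tagged (basis p)).
  - exact: s2valP' (tagged (basis p)).
transitivity #|{: {p : T & I p}}|; last first.
  rewrite card_tagged sumnE big_map big_enum.
  by apply: eq_bigr => p _; rewrite (rank_eq_card (xi p) (xs p)).
pose X (u : {p : T & I p}) := inj (tag u) (x (tag u) (tagged u)).
apply: (@rank_eq_card _ _ X).
  move=> c c0 [q i]; apply: (xi q (fun i => c (Tagged I i))).
  have {c0} := congr1 (proj q) c0.
  rewrite raddf0 => projq0; rewrite -[RHS]projq0.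
  rewrite sum_tagged raddf_sum (bigD1 q) //=.
  rewrite [Y in _ + Y]big1 ?addr0 => [|p qp]; last first.
    by rewrite raddf_sum big1 // => j _; rewrite raddfMz injN ?mul0rz.
  by rewrite raddf_sum; apply: eq_bigr => j _; rewrite raddfMz injK.
move=> a; have [b ->] := injS a.
have /all_sig2 [m m0 /(fun mc p => cid (mc p)) /all_sig [c mc]] p :
  {m : int | m != 0 & exists c, b p *~ m = \sum_i x p i *~ c i} by exact/cid2/xs.
(* The multiples used in different summands are brought to a common one. *)
exists (\prod_p m p); first by apply/prodf_neq0.
exists (fun u => c (tag u) (tagged u) * \prod_(q | q != tag u) m q).
rewrite sum_tagged mulrz_suml; apply: eq_bigr => p _.
rewrite (bigD1 p) //= mulrzA -raddfMz mc raddf_sum mulrz_suml.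
by apply: eq_bigr => i _; rewrite raddfMz mulrzA.
Qed.
End Rank.

(** * Subgroups and relative lower central series *)

Section Subgroups.
Local Open Scope group_scope.
Local Open Scope classical_set_scope.
Variable G : groupType.
Implicit Types (S H K N Q : set G) (x y z g : G).

Definition is_subgroup H : Prop :=
  [/\ H 1, forall x y, H x -> H y -> H (x * y) & forall x, H x -> H x^-1].

Definition is_normal N : Prop :=
  is_subgroup N /\ forall x g, N x -> N (x ^ g).

Definition centralizer S : set G := fun x => forall s, S s -> commute x s.

Lemma gen_is_subgroup S : is_subgroup (gen_subgroup S).
Proof. by split; [exact: gen_one|exact: gen_mul|exact: gen_inv]. Qed.

Lemma gen_subgroup_min S H :
  is_subgroup H -> S `<=` H -> gen_subgroup S `<=` H.
Proof. by move=> [H1 HM HV] SH x; elim=> *; auto. Qed.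

Lemma gen_subgroupS S S' : S `<=` S' -> gen_subgroup S `<=` gen_subgroup S'.
Proof.
move=> SS'; apply: gen_subgroup_min (gen_is_subgroup _) _ => x /SS'.
exact: gen_mem.
Qed.

Lemma centralizer_is_subgroup S : is_subgroup (centralizer S).
Proof.
split=> [s _|x y xS yS s Ss|x xS s Ss]; apply: commute_sym.
- exact: commute1.
- by apply: commuteM; apply: commute_sym; auto.
- by apply: commuteV; apply: commute_sym; auto.
Qed.

Lemma gen_subgroup_commute S S' :
  (forall s s', S s -> S' s' -> commute s s') ->
  forall x y, gen_subgroup S x -> gen_subgroup S' y -> commute x y.
Proof.
move=> SS' x y Sx S'y; move: x Sx y S'y.
apply: (gen_subgroup_min (centralizer_is_subgroup _)) => s Ss y S'y.
apply: commute_sym; move: y S'y s Ss.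
apply: (gen_subgroup_min (centralizer_is_subgroup _)) => s' S's' s Ss.
by apply/commute_sym/SS'.
Qed.

Lemma commgMr x y z : [~ x, y * z] = [~ x, z] * [~ x, y] ^ z.
Proof. by rewrite /commg /conjg !gnorm. Qed.

Lemma commgMl x y z : [~ x * y, z] = [~ x, z] ^ y * [~ y, z].
Proof. by rewrite /commg /conjg !gnorm. Qed.

Lemma commgVr x y : [~ x, y^-1] = [~ x, y]^-1 ^ y^-1.
Proof. by rewrite /commg /conjg !gnorm. Qed.

Lemma commgVl x y : [~ x^-1, y] = [~ x, y]^-1 ^ x^-1.
Proof. by rewrite /commg /conjg !gnorm. Qed.

(** Modulo a normal subgroup [N], the elements that commute with [x] form a
    subgroup, and so do the central elements: it is enough to compute
    commutators of generators. *)
Lemma commg_normal_r N x : is_normal N -> is_subgroup (fun g => N [~ x, g]).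
Proof.
move=> [[N1 NM NV] NJ]; split=> [|y z Ny Nz|y Ny].
- by rewrite commg1.
- by rewrite commgMr; apply/NM/NJ.
- by rewrite commgVr; apply/NJ/NV.
Qed.

Lemma commg_normal_l N :
  is_normal N -> is_subgroup (fun x => forall g, N [~ x, g]).
Proof.
move=> [[N1 NM NV] NJ]; split=> [g|y z Ny Nz g|y Ny g].
- by rewrite comm1g.
- by rewrite commgMl; apply/NM/Nz/NJ/Ny.
- by rewrite commgVl; apply/NJ/NV/Ny.
Qed.

Lemma commg_central_factor x y z t :
  commute z x -> commute z y -> commute t x -> commute t y -> commute z t ->
  [~ x * z, y * t] = [~ x, y].
Proof.
move=> zx zy tx ty zt.
have c_xy u : commute u x -> commute u y -> [~ x, y] ^ u = [~ x, y].
  move=> ux uy; apply/conjg_fixP/commgP/commute_sym; rewrite /commg /conjg.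
  by do ![apply: commuteM|apply: commuteV].
have c1 (u v : G) : commute u v -> [~ u, v] = 1 by move=> uv; apply/eqP/commgP.
rewrite commgMl !commgMr (c1 x t (commute_sym tx)) (c1 z t zt) (c1 z y zy).
by rewrite conj1g !mul1g mulg1 !c_xy.
Qed.

(** The lower central series of a subgroup given by its set of elements, which is
    no [groupType] of its own; the indexing is that of [lcs]. *)
Fixpoint sub_lcs H (k : nat) : set G :=
  if k is (k'.+1 as j).+1 then comm_subgroup (sub_lcs H j) H else H.

Lemma lcs_sub_lcs k : lcs k = sub_lcs [set: G] k.
Proof. by case: k => //; elim=> //= k ->. Qed.

Lemma sub_lcs_is_subgroup H k : is_subgroup H -> is_subgroup (sub_lcs H k).
Proof. by case: k => [|[|k]] //= _; exact: gen_is_subgroup. Qed.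

Lemma sub_lcsJ H k x y : is_subgroup H ->
  sub_lcs H k x -> H y -> sub_lcs H k (x ^ y).
Proof.
move=> [H1 HM HV].
have HJ u v : H u -> H v -> H (u ^ v) by rewrite /conjg; auto.
elim: k x y => [|[|k] IHk] x y; rewrite /= => Hx Hy.
- exact: HJ.
- exact: HJ.
elim: Hx => {x} [x [u [v [Hu Hv ->]]]||x1 x2 _ Hx1 _ Hx2|x _ Hx].
- rewrite conjRg; apply: gen_mem; exists (u ^ y), (v ^ y).
  by split=> //; [exact: IHk | exact: HJ].
- by rewrite conj1g; exact: gen_one.
- by rewrite conjMg; exact: gen_mul.
- by rewrite conjVg; exact: gen_inv.
Qed.

Lemma sub_lcs_succ H k : is_subgroup H -> sub_lcs H k.+1 `<=` sub_lcs H k.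
Proof.
move=> sgH; case: k => [|k] // x.
have [sg1 sgM sgV] := sub_lcs_is_subgroup k.+1 sgH.
apply: gen_subgroup_min => //= _ [u [v [Hu Hv ->]]].
by rewrite /commg; apply: sgM; [exact: sgV | exact: (sub_lcsJ sgH)].
Qed.

Lemma sub_lcs_le H j k : is_subgroup H -> (j <= k)%N ->
  sub_lcs H k `<=` sub_lcs H j.
Proof.
move=> sgH; elim: k => [|k IHk]; first by rewrite leqn0 => /eqP->.
rewrite leq_eqVlt => /orP [/eqP->//|jk]; rewrite ltnS in jk.
by move=> x /(sub_lcs_succ sgH)/IHk; exact.
Qed.

Lemma sub_lcsS H K k : H `<=` K -> sub_lcs H k `<=` sub_lcs K k.
Proof.
move=> HK; elim: k => [|[|k] IHk] //=.
by apply: gen_subgroupS => _ [u [v [Hu Hv ->]]]; exists u, v; split=> //;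
  [exact: IHk | exact: HK].
Qed.

(** Each element of [H = gen_subgroup S] is [x * y] with [x] in [K] and [y] in
    [Q]. The factors [y] commute with each other and with [K], so they disappear
    from all commutators. [K] need not be contained in [H]. *)
Lemma sub_lcs_central_factor S K Q k : (2 <= k)%N ->
    is_subgroup K -> is_subgroup Q ->
    (forall x y, K x -> Q y -> commute x y) ->
    (forall x y, Q x -> Q y -> commute x y) ->
    (forall s, S s -> exists x y, [/\ K x, Q y & s = x * y]) ->
  sub_lcs (gen_subgroup S) k `<=` sub_lcs K k.
Proof.
move=> + sgK sgQ cKQ cQQ SKQ.
have HKQ h : gen_subgroup S h -> exists x y, [/\ K x, Q y & h = x * y].
  move: h; apply: gen_subgroup_min SKQ.
  have [[K1 KM KV] [Q1 QM QV]] := (sgK, sgQ).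
  split=> [|_ _ [x [y [Kx Qy ->]]] [x' [y' [Kx' Qy' ->]]]|_ [x [y [Kx Qy ->]]]].
  - by exists 1, 1; split; rewrite ?mulg1.
  - exists (x * x'), (y * y'); split; auto.
    by rewrite !mulgA; congr (_ * _); rewrite -!mulgA (cKQ x').
  - by exists x^-1, y^-1; split; auto; rewrite cKQ // invgM.
case: k => [|[|k]] // _; elim: k => [|k IHk];
    apply: gen_subgroup_min (gen_is_subgroup _) _ => _ [u [v [Hu]]]
      /HKQ [x [y [Kx Qy ->]]] ->.
  have [x' [y' [Kx' Qy' ->]]] := HKQ u Hu.
  rewrite commg_central_factor; try by [apply/commute_sym/cKQ|apply: cQQ].
  by apply: gen_mem; exists x', x.
(* From the second step on, the left argument is already in [K]. *)
have {}Hu := IHk u Hu.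
have Ku : K u by apply: (sub_lcs_le (k := k.+2) sgK (leq0n _)).
rewrite -[u]mulg1 commg_central_factor.
- by apply: gen_mem; exists u, x.
- exact/commute_sym/commute1.
- exact/commute_sym/commute1.
- exact/commute_sym/cKQ.
- exact/commute_sym/cKQ.
- exact/commute_sym/commute1.
Qed.

End Subgroups.

Section Morphisms.
Local Open Scope group_scope.
Local Open Scope classical_set_scope.
Variables (F G : groupType) (f : UMagmaMorphism.type F G).

Lemma lcs_morph k x : lcs k x -> lcs k (f x).
Proof.
elim: k x => [|[|k] IHk] //= x.
elim=> {x} [_ [u [v [Hu _ ->]]]||x y _ Hx _ Hy|x _ Hx].
- by rewrite gmulfR; apply: gen_mem; exists (f u), (f v); split=> //; exact: IHk.
- by rewrite gmulf1; exact: gen_one.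
- by rewrite gmulfM; exact: gen_mul.
- by rewrite gmulfV; exact: gen_inv.
Qed.

Lemma morph_is_subgroup (H : set F) : is_subgroup H -> is_subgroup (f @` H).
Proof.
move=> [H1 HM HV]; split.
- by exists 1; rewrite ?gmulf1.
- by move=> _ _ [x Hx <-] [y Hy <-]; exists (x * y); rewrite ?gmulfM; auto.
- by move=> _ [x Hx <-]; exists x^-1; rewrite ?gmulfV; auto.
Qed.

Lemma sub_lcs_range k : sub_lcs (f @` setT) k `<=` f @` lcs k.
Proof.
elim: k => [|[|k] IHk] //=; apply: gen_subgroup_min.
  by apply: morph_is_subgroup; exact: gen_is_subgroup.
move=> _ [u [_ [/IHk [x Hx <-] [y _ <-] ->]]].
by exists [~ x, y]; rewrite ?gmulfR //; apply: gen_mem; exists x, y.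
Qed.

End Morphisms.

(** * Lower central quotients *)

Section GradedQuotients.
Import GRing.Theory.
Local Open Scope group_scope.
Local Open Scope quotient_scope.
Local Open Scope classical_set_scope.

Section Class.
Variables (G : groupType) (k : nat).
Implicit Types (x y : G).

(** Total on [G], so that no proof of membership has to be carried along; outside
    [lcs k] the value is the junk 0. *)
Definition lcq_class x : lcq G k := \pi_(lcq G k) (insubd (1 : lcs_sub G k) x).

Lemma val_insubd_lcs x : lcs k x -> val (insubd (1 : lcs_sub G k) x) = x.
Proof. by move=> kx; apply: insubdK; exact/lcs_predP. Qed.

Lemma lcq_class_eq x y : lcs k x -> lcs k y ->
  lcq_class x = lcq_class y <-> lcs k.+1 (x^-1 * y).
Proof.
move=> kx ky; rewrite -{2}(val_insubd_lcs kx) -{2}(val_insubd_lcs ky).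
by rewrite -gmulfV -gmulfM; split => [/eqP/lcq_eqP|/lcq_eqP/eqP].
Qed.

Lemma lcq_classM x y : lcs k x -> lcs k y ->
  lcq_class (x * y) = (lcq_class x + lcq_class y)%R.
Proof.
move=> kx ky; apply: esym; apply: etrans (lcq_piM _ _) _.
congr (\pi_ _ _); apply: val_inj.
by rewrite gmulfM /= !val_insubd_lcs //; exact: lcsM.
Qed.

Lemma lcq_class0 x : lcs k.+1 x -> lcs k x -> lcq_class x = 0%R.
Proof.
move=> k1x kx; have k1 := @lcs1 G k.
have /(_ (lcq_class 1)) : forall a : lcq G k,
    (a + lcq_class 1 = a -> lcq_class 1 = 0)%R.
  by move=> a /(canRL (addKr _)) ->; rewrite addNr.
rewrite -lcq_classM // mulg1 => /(_ erefl) <-.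
by apply/esym/lcq_class_eq; rewrite // invg1 mul1g.
Qed.

Lemma lcq_classV x : lcs k x -> lcq_class x^-1 = (- lcq_class x)%R.
Proof.
move=> kx; apply/eqP; rewrite -addr_eq0 -lcq_classM //; last exact: lcsV.
by rewrite mulVg; apply/eqP/lcq_class0; exact: lcs1.
Qed.

Lemma lcq_class_surj (a : lcq G k) : exists2 x, lcs k x & a = lcq_class x.
Proof.
rewrite -[a]reprK; exists (val (repr a)); first exact: lcs_subP.
by rewrite /lcq_class valKd.
Qed.
End Class.

Section Map.
Variables (F G : groupType) (f : UMagmaMorphism.type F G) (k : nat).

Definition lcq_map (a : lcq F k) : lcq G k := lcq_class k (f (val (repr a))).

Lemma lcq_map_class x : lcs k x -> lcq_map (lcq_class k x) = lcq_class k (f x).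
Proof.
move=> kx; apply/lcq_class_eq;
  do ?[by apply: lcs_morph; exact: lcs_subP|exact: lcs_morph].
rewrite -gmulfV -gmulfM; apply: lcs_morph.
rewrite -{2}(val_insubd_lcs kx) -gmulfV -gmulfM.
by apply/lcq_eqP; rewrite reprK.
Qed.

Lemma lcq_map_is_zmod_morphism : zmod_morphism lcq_map.
Proof.
move=> a b; have [x kx ->] := lcq_class_surj a.
have [y ky ->] := lcq_class_surj b.
have kxVy := lcsM kx (lcsV ky).
rewrite -lcq_classV // -lcq_classM ?lcq_map_class //; last exact: lcsV.
rewrite gmulfM gmulfV lcq_classM ?lcq_classV //; try exact: lcs_morph.
by apply/lcsV/lcs_morph.
Qed.
HB.instance Definition _ :=
  GRing.isZmodMorphism.Build (lcq F k) (lcq G k) lcq_map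
    lcq_map_is_zmod_morphism.
End Map.

Lemma lcs_le (G : groupType) j k : (j <= k)%N -> @lcs G k `<=` @lcs G j.
Proof. by move=> jk; rewrite !lcs_sub_lcs; exact: sub_lcs_le. Qed.

Section FinitelyGenerated.
Variables (G : groupType) (gens : seq G).
Hypothesis gens_gen : forall x, gen_subgroup [set` gens] x.

(** Modulo [lcs k.+3] all of [lcs k.+2] is central, so the commutator of an
    element of [lcs k.+1] with an element of [G] is additive in both arguments
    and can be computed on generators. *)
Lemma lcs_finite_generation k : exists2 s : seq G, {in s, forall x, lcs k.+1 x} &
  forall x, lcs k.+1 x -> gen_subgroup ([set` s] `|` lcs k.+2) x.
Proof.
elim: k => [|k [s sk sgen]].
  exists gens => // x _; have := gens_gen x.
  by apply: gen_subgroupS => y; left.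
exists [seq [~ u, v] | u <- s, v <- gens].
  by move=> _ /allpairsP [[u v] [/sk ku _ ->]]; exact: lcsR.
pose S := [set` [seq [~ u, v] | u <- s, v <- gens]] `|` @lcs G k.+3.
have lcs_is_subgroup j : is_subgroup (@lcs G j).
  by split; [exact: lcs1|exact: lcsM|exact: lcsV].
have Slcs : gen_subgroup S `<=` @lcs G k.+2.
  apply: gen_subgroup_min => // x [/allpairsP [[u v] [/sk ku _ ->]]|].
    exact: lcsR.
  exact: lcs_le.
have Snorm : is_normal (gen_subgroup S).
  split=> [|x g Sx]; first exact: gen_is_subgroup.
  rewrite -[x ^ g](mulVKg x) -commgEl; apply: (gen_mul Sx).
  by apply: gen_mem; right; apply: lcsR; exact: Slcs.
apply: gen_subgroup_min (gen_is_subgroup _) _ => _ [u [g [ku _ ->]]].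
move: u {ku}(sgen u ku) g.
apply: gen_subgroup_min (commg_normal_l Snorm) _ => u [us|ku] g; last first.
  by apply: gen_mem; right; exact: lcsR.
move: g (gens_gen g).
apply: gen_subgroup_min (commg_normal_r _ Snorm) _ => g gg.
by apply: gen_mem; left; apply/allpairsP; exists (u, g).
Qed.

Lemma lcq_zspans k : exists I : finType, exists x : I -> lcq G k.+1, zspans x.
Proof.
have [s sk sgen] := lcs_finite_generation k.
exists 'I_(size s), (fun i => lcq_class k.+1 (tnth (in_tuple s) i)) => a.
exists 1%R => //; have [x kx ->] := lcq_class_surj a; rewrite mulr1z.
suff: lcs k.+1 x /\ exists c, lcq_class k.+1 x =
    (\sum_i lcq_class k.+1 (tnth (in_tuple s) i) *~ c i)%R by case.
move: x {kx}(sgen x kx); apply: gen_subgroup_min.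
  split=> [|x y [kx [c xc]] [ky [d yd]]|x [kx [c xc]]].
  - split; first exact: lcs1.
    exists (fun=> 0%R); rewrite lcq_class0 ?big1 //; exact: lcs1.
  - split; first exact: lcsM.
    exists (fun i => c i + d i)%R; rewrite lcq_classM // xc yd -big_split /=.
    by apply: eq_bigr => i _; rewrite mulrzDr.
  - split; first exact: lcsV.
    exists (fun i => - c i)%R; rewrite lcq_classV // xc -sumrN.
    by apply: eq_bigr => i _; rewrite mulrNz.
move=> x [xs|kx].
  split; first exact: sk.
  have /tnthP [i xi] : x \in in_tuple s by [].
  exists (fun j => (j == i)%:R%R); rewrite (bigD1 i) //= eqxx mulr1z -xi.
  by rewrite big1 ?addr0 // => j /negPf->; rewrite mulr0z.
have kx' : lcs k.+1 x by exact: lcs_le kx.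
by split=> //; exists (fun=> 0%R); rewrite lcq_class0 ?big1.
Qed.
End FinitelyGenerated.

End GradedQuotients.

(** * Groups generated by blocks *)

Section BlockStructure.
Local Open Scope group_scope.
Local Open Scope classical_set_scope.
Variables (G : groupType) (X T : finType) (g : X -> G) (I : T -> {set X}).

Definition linked (i j : X) := [exists p, (i \in I p) && (j \in I p)].

Definition blocks_meet (p q : T) := (p != q) && [exists i, (i \in I p) && (i \in I q)].

Definition block_subgroup p : set G :=
  gen_subgroup (fun x => exists2 i, i \in I p & x = g i).

Definition punctured_subgroup p i : set G :=
  gen_subgroup (fun x => exists2 j, (j \in I p) && (j != i) & x = g j).

Hypothesis g_gen : forall x, gen_subgroup (range g) x.
Hypothesis unlinked_commute : forall i j, ~~ linked i j -> commute (g i) (g j).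
Hypothesis block_center : forall p, exists z : G,
  (forall i, i \in I p -> commute z (g i)) /\
  (forall i, i \in I p -> exists2 x, punctured_subgroup p i x & g i = x * z).
Hypothesis I_meet : forall p q i j, p != q ->
  i \in I p -> i \in I q -> j \in I p -> j \in I q -> i = j.
(* Otherwise [p], [q], [r] and [p], [r], [s] would be two triangles with a common
   edge. *)
Hypothesis no_adjacent_triangles : forall p q r s,
  blocks_meet p q -> blocks_meet q r -> blocks_meet p r ->
  blocks_meet r s -> blocks_meet p s -> s = q.

Lemma block_is_subgroup p : is_subgroup (block_subgroup p).
Proof. exact: gen_is_subgroup. Qed.

(** The generator [g i] is an element of the punctured subgroup up to the central
    element of the block, which does not contribute to commutators. *)
Lemma sub_lcs_block_punctured p i k : i \in I p -> (2 <= k)%N ->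
  sub_lcs (block_subgroup p) k `<=` sub_lcs (punctured_subgroup p i) k.
Proof.
move=> pi k2; have [z [zc zf]] := block_center p.
apply: (@sub_lcs_central_factor _ _ _ (gen_subgroup [set z])) => //.
- exact: gen_is_subgroup.
- exact: gen_is_subgroup.
- apply: gen_subgroup_commute => _ _ [j /andP [pj _] ->] ->.
  by apply/commute_sym/zc.
- by apply: gen_subgroup_commute => _ _ -> ->.
move=> _ [j pj ->]; have [ji|ji] := eqVneq j i; last first.
  exists (g j), 1; rewrite mulg1; split=> //; last exact: gen_one.
  by apply: gen_mem; exists j => //; rewrite pj.
have [x xK gx] := zf i pi; exists x, z; rewrite ji; split=> //.
exact: gen_mem.
Qed.

(** The argument depends on how many elements of block [p] lie in a common block
    with [c]. At most one can be left out, by [sub_lcs_block_punctured], and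
    nothing remains to prove. Two of them, [i] and [j], put [p] in a triangle
    [p], [q], [r]; leave out [i]. The generators of block [p] other than [g i] and
    [g j] centralize [K], the punctured subgroup of [r] at [j], while [g j] does so
    up to a factor [y] in [K]. The commutators then centralize [K], which contains
    [g c]. *)
Lemma outside_commute_derived p c : c \notin I p ->
  forall x, sub_lcs (block_subgroup p) 2 x -> commute (g c) x.
Proof.
move=> pc.
have gc_cent S : (forall x, S x -> commute (g c) x) ->
    forall x, gen_subgroup S x -> commute (g c) x.
  move=> Sc x Sx; apply: (@gen_subgroup_commute _ [set g c] S) => //; last exact: gen_mem.
  by move=> _ y -> /Sc.
case: (pickP [pred i | (i \in I p) && linked i c]) => [i /andP [pi ic]|nl]; last first.
  move=> x /(sub_lcs_le (block_is_subgroup p) (leq0n 2)).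
  apply: gc_cent => _ [i pi ->]; apply/commute_sym/unlinked_commute.
  by have /= := nl i; rewrite pi /= => ->.
move=> x /(sub_lcs_block_punctured pi (leqnn 2)).
case: (pickP [pred j | [&& j \in I p, j != i & linked j c]])
    => [j /and3P [pj ji jc]|nl]; last first.
  move/(sub_lcs_le (gen_is_subgroup _) (leq0n 2)); move: x.
  apply: gc_cent => _ [j /andP [pj ji] ->]; apply/commute_sym/unlinked_commute.
  by have /= := nl j; rewrite pj ji /= => ->.
have /existsP [q /andP [qi qc]] := ic.
have /existsP [r /andP [rj rc]] := jc.
have pq : p != q by apply: contraNneq pc => ->.
have pr : p != r by apply: contraNneq pc => ->.
have qr : q != r.
  apply: contra_neq ji => qr; rewrite -qr in rj.
  exact: (I_meet pq).
(* A block [s] through such [l] and [m] would give a second triangle [p], [r],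
   [s]. *)
have far l m : l \in I p -> l != i -> l != j -> m \in I r -> m != j ->
    commute (g l) (g m).
  move=> pl li lj rm mj; apply/unlinked_commute/negP => /existsP [s /andP [sl sm]].
  have qs : q != s.
    by apply: contraNneq li => qs; rewrite (I_meet pq pl _ pi qi) // qs.
  have rs : r != s.
    by apply: contraNneq lj => rs; rewrite (I_meet pr pl _ pj rj) // rs.
  have ps : p != s.
    by apply: contraNneq mj => ps; rewrite (I_meet pr _ rm pj rj) // ps.
  case/negP: qs; apply/eqP/esym/(@no_adjacent_triangles p q r s);
    rewrite /blocks_meet ?pq ?qr ?pr ?rs ?ps /=.
  - by apply/existsP; exists i; rewrite pi qi.
  - by apply/existsP; exists c; rewrite qc rc.
  - by apply/existsP; exists j; rewrite pj rj.
  - by apply/existsP; exists m; rewrite rm sm.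
  - by apply/existsP; exists l; rewrite pl sl.
have [z [zc zf]] := block_center r; have [y yK gj] := zf j rj.
pose C := centralizer (punctured_subgroup r j).
have sgC : is_subgroup C by exact: centralizer_is_subgroup.
have yr : gen_subgroup [set y] `<=` punctured_subgroup r j.
  by apply: gen_subgroup_min => [|_ ->//]; exact: gen_is_subgroup.
have CS a : (forall m, m \in I r -> m != j -> commute a (g m)) -> C a.
  move=> am b; apply: (@gen_subgroup_commute _ [set a]) (gen_mem _) => //.
  by move=> _ _ -> [m /andP [rm mj] ->]; exact: am.
move=> Kx; apply/commute_sym.
suff Cx : C x.
  apply: Cx; apply: gen_mem; exists c => //; rewrite rc /=.
  by apply: contraNneq pc => ->.
have := sub_lcs_central_factor (k := 2) isT sgC (gen_is_subgroup [set y]) _ _ _ Kx.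
move=> H; apply: (sub_lcs_le sgC (leq0n 2)); apply: H => /=.
- by move=> a b Ca /yr; exact: Ca.
- by apply: gen_subgroup_commute => _ _ -> ->.
move=> _ [l /andP [pl li] ->]; have [->|lj] := eqVneq l j.
  have Cz : C z by apply: CS => m rm _; exact: zc.
  exists z, y; split=> //; first exact: gen_mem.
  by rewrite gj (Cz y yK).
exists (g l), 1; rewrite mulg1; split=> //; last exact: gen_one.
by apply: CS => m rm mj; exact: far.
Qed.

Definition blocks_lcs k : set G :=
  gen_subgroup (fun x => exists p, sub_lcs (block_subgroup p) k x).

Lemma commg_generators N x : is_normal N ->
  (forall i, N [~ x, g i]) -> forall y, N [~ x, y].
Proof.
move=> Nn Nx y; move: y (g_gen y).
by apply: gen_subgroup_min (commg_normal_r x Nn) _ => _ [i _ <-].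
Qed.

(** Generators in block [p] normalize the lower central series of that block, and
    generators outside it centralize the series by [outside_commute_derived]. *)
Lemma blocks_lcs_normal k : (2 <= k)%N -> is_normal (blocks_lcs k).
Proof.
move=> k2; split=> [|x y Nx]; first exact: gen_is_subgroup.
(* Both signs are needed for [Q] to be closed under inverses. *)
pose Q : set G := fun y => forall x, blocks_lcs k x ->
  blocks_lcs k (x ^ y) /\ blocks_lcs k (x ^ y^-1).
suff /(_ _ (g_gen y)) Qy : gen_subgroup (range g) `<=` Q by have [] := Qy x Nx.
apply: gen_subgroup_min => [|_ [i _ <-] {Nx}x].
  split=> [u Nu|a b Qa Qb u Nu|a Qa u Nu].
  - by rewrite invg1 conjg1.
  - rewrite invgM !conjgM; split; first by have [/Qb[]] := Qa u Nu.
    by have [_ /Qa[]] := Qb u Nu.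
  - by rewrite invgK; have [] := Qa u Nu.
suff conjN h : (forall p, i \in I p -> block_subgroup p h) ->
    (forall u, commute (g i) u -> commute h u) ->
    blocks_lcs k x -> blocks_lcs k (x ^ h).
  have gi p : i \in I p -> block_subgroup p (g i).
    by move=> pi; apply: gen_mem; exists i.
  move=> Nx; split; apply: conjN Nx => // [p /gi /gen_inv //|u iu].
  by apply/commute_sym/commuteV/commute_sym.
move=> hB hC; elim=> {x} [x [p px]||a b _ Na _ Nb|a _ Na].
- apply: gen_mem; exists p; case: (boolP (i \in I p)) => pi.
    exact: (sub_lcsJ (block_is_subgroup p) px (hB p pi)).
  rewrite (_ : x ^ h = x) //; apply/conjg_fixP/commgP/commute_sym/hC.
  apply: (outside_commute_derived pi).
  exact: (sub_lcs_le (block_is_subgroup p) k2).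
- by rewrite conj1g; exact: gen_one.
- by rewrite conjMg; exact: gen_mul.
- by rewrite conjVg; exact: gen_inv.
Qed.

(** Modulo the terms of index [k.+1], each generator of [G] commutes with the
    lower central series of each block: either it is in the block, or
    [outside_commute_derived] applies. *)
Lemma lcs_blocks k : (2 <= k)%N -> @lcs G k `<=` blocks_lcs k.
Proof.
case: k => [|[|k]] // _; elim: k => [|k IHk].
  have N2 := blocks_lcs_normal (leqnn 2).
  apply: gen_subgroup_min (gen_is_subgroup _) _ => _ [u [v [_ _ ->]]].
  move: u (g_gen u) v.
  apply: gen_subgroup_min (commg_normal_l N2) _ => _ [i _ <-].
  apply: commg_generators => // j.
  case: (boolP (linked i j)) =>
      [/existsP [p /andP [pi pj]]|/unlinked_commute/commgP/eqP ->].
    apply: gen_mem; exists p; apply: gen_mem; exists (g i), (g j).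
    by split=> //; apply: gen_mem; [exists i|exists j].
  exact: gen_one.
have Nk := blocks_lcs_normal (isT : (2 <= k.+3)%N).
apply: gen_subgroup_min (gen_is_subgroup _) _ => _ [u [v [/IHk + _ ->]]].
move=> ku; move: u ku v.
apply: gen_subgroup_min (commg_normal_l Nk) _ => u [p pu].
apply: commg_generators => // i.
case: (boolP (i \in I p)) => pi.
  apply: gen_mem; exists p; apply: gen_mem; exists u, (g i).
  by split=> //; apply: gen_mem; exists i.
suff /commgP/eqP -> : commute u (g i) by exact: gen_one.
apply/commute_sym/(outside_commute_derived pi).
exact: (sub_lcs_le (block_is_subgroup p) (isT : 2 <= k.+2)).
Qed.

End BlockStructure.

(** * Homomorphisms out of presented groups *)

Section Presentations.
Local Open Scope group_scope.
Local Open Scope quotient_scope.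
Local Open Scope classical_set_scope.

Definition word_value (H : groupType) n (h : 'I_n -> H) (w : word n) : H :=
  \prod_(l <- w) (if l.2 then h l.1 else (h l.1)^-1).

Lemma word_value_morph (F H : groupType) (f : UMagmaMorphism.type F H) n
    (h : 'I_n -> F) w : f (word_value h w) = word_value (f \o h) w.
Proof.
by rewrite gmulf_prod; apply: eq_bigr => -[i []] _ //=; rewrite gmulfV.
Qed.

Lemma word_value_positive (H : groupType) n (h : 'I_n -> H) (s : seq 'I_n) :
  word_value h [seq (i, true) | i <- s] = \prod_(i <- s) h i.
Proof. by rewrite /word_value big_map. Qed.

Section Lift.
Variables (n : nat) (rels : word n -> word n -> Prop).

Definition pgen (i : 'I_n) : presented rels := \pi_(presented rels) [:: (i, true)].

Lemma word_value_pgen w : word_value pgen w = \pi_(presented rels) w.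
Proof.
elim: w => [|[i b] w IHw]; first by rewrite /word_value big_nil.
rewrite /word_value big_cons -/(word_value pgen w) IHw.
suff -> : (if b then pgen i else (pgen i)^-1) = \pi_(presented rels) [:: (i, b)].
  exact: (presented_piM rels [:: (i, b)] w).
case: b => //; apply: mulg1_eq; apply: etrans (presented_piM _ _ _) _.
exact/eqP/presented_eqP/(wc_cancel _ i true).
Qed.

Lemma word_value_gen (H : groupType) (h : 'I_n -> H) w :
  gen_subgroup (range h) (word_value h w).
Proof.
apply: (big_rec (gen_subgroup (range h))) => [|[i b] x _ xh]; first exact: gen_one.
have hi : gen_subgroup (range h) (h i) by apply: gen_mem; exists i.
by apply: gen_mul => //; case: b => //=; exact: gen_inv.
Qed.

Lemma pgen_gen x : gen_subgroup (range pgen) x.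
Proof. by rewrite -[x]reprK -word_value_pgen; exact: word_value_gen. Qed.

Lemma presented_lift (H : groupType) (h : 'I_n -> H) :
  (forall u v, rels u v -> word_value h u = word_value h v) ->
  exists f : UMagmaMorphism.type (presented rels) H, forall i, f (pgen i) = h i.
Proof.
move=> hrel.
have hcong u v : word_cong rels u v -> word_value h u = word_value h v.
  elim=> {u v} //.
  - by move=> i [] /=; rewrite /word_value !big_cons !big_nil /= mulg1 ?mulgV ?mulVg.
  - by move=> u v w _ -> _.
  - by move=> u u' v v' _ Hu _ Hv; rewrite /word_value !big_cat; congr (_ * _).
pose f (x : presented rels) := word_value h (repr x).
have fpi w : f (\pi_(presented rels) w) = word_value h w.
  by apply/esym/hcong/presented_eqP; rewrite reprK.
have f_morph : monoid_morphism f.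
  split=> [|x y]; first by rewrite fpi /word_value big_nil.
  by rewrite fpi /word_value big_cat.
pose f' : UMagmaMorphism.type (presented rels) H :=
  HB.pack f (isUMagmaMorphism.Build (presented rels) H f f_morph).
exists f' => i; rewrite /= fpi /word_value big_cons big_nil mulg1 //.
Qed.
End Lift.

End Presentations.

(** * Cyclic relations *)

Section CyclicRelations.
Local Open Scope group_scope.
Local Open Scope classical_set_scope.
Variable G : groupType.

Definition cyclic_products_agree (X : eqType) (g : X -> G) (s : seq X) : Prop :=
  forall j, (j < size s)%N -> \prod_(i <- s) g i = \prod_(i <- rot j s) g i.

Lemma cyclic_relP n (g : 'I_n -> G) (s : seq 'I_n) :
  (forall u v, cyclic_rel s u v -> word_value g u = word_value g v) <->
  cyclic_products_agree g (rev s).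
Proof.
split=> [gs j|gs _ _ [-> [j js ->]]].
  rewrite size_rev => js; rewrite -!word_value_positive map_rot.
  by apply: gs; split=> //; exists j.
by rewrite -map_rot !word_value_positive; apply: gs; rewrite size_rev.
Qed.

Lemma cyclic_products_agree1 (X : eqType) (g : X -> G) (s : seq X) :
  \prod_(i <- s) g i = 1 -> cyclic_products_agree g s.
Proof.
move=> s1 j _; rewrite s1 /rot big_cat /=; apply/esym.
by rewrite -{1}[s](cat_take_drop j) big_cat /= in s1; rewrite -(mulg1_eq s1) mulVg.
Qed.

Lemma prodg_unique (X : eqType) (g : X -> G) (s : seq X) i :
  uniq s -> i \in s -> (forall j, j \in s -> j != i -> g j = 1) ->
  \prod_(j <- s) g j = g i.
Proof.
move=> + /splitPr def_s; case: def_s => s1 s2; rewrite cat_uniq => /and3P [_].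
rewrite /= negb_or => /andP [is1 _] /andP [is2 _] g1.
have side s' : {subset s' <= s1 ++ i :: s2} -> i \notin s' ->
    \prod_(j <- s') g j = 1.
  move=> ss' is'; rewrite big1_seq // => j /andP [_ js'].
  by apply: g1; [exact: ss' | apply: contraNneq is' => <-].
rewrite big_cat big_cons /= !side ?mul1g ?mulg1 // => j js.
  by rewrite mem_cat inE js !orbT.
by rewrite mem_cat js.
Qed.

(** For the relations of the other blocks under the retraction to one block: at
    most one of their generators survives. *)
Lemma cyclic_products_agree_meet1 (X : eqType) (g : X -> G) (s : seq X) :
  uniq s -> (forall i j, i \in s -> j \in s -> g i != 1 -> g j != 1 -> i = j) ->
  cyclic_products_agree g s.
Proof.
move=> us g1 j _.
have [/hasP [i si gi]|/hasPn gs] := boolP (has (fun i => g i != 1) s).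
  have gN l : l \in s -> l != i -> g l = 1.
    by move=> sl; apply: contra_neq_eq => gl; exact: g1.
  rewrite !(@prodg_unique _ g _ i) ?rot_uniq ?mem_rot // => l.
  by rewrite mem_rot; exact: gN.
by rewrite !big1_seq // => l; rewrite ?mem_rot => /andP [_ /gs/negPn/eqP].
Qed.

Section Center.
Variables (X : eqType) (g : X -> G) (s : seq X).
Hypothesis cyc : cyclic_products_agree g s.

(** Write the product as [a * b], with [a] the product of a prefix; by the cyclic
    relation it is also [b * a], so it commutes with [a]. Two consecutive
    prefixes differ by one generator. *)
Lemma cyclic_product_central i : i \in s -> commute (\prod_(j <- s) g j) (g i).
Proof.
set z := \prod_(j <- s) g j.
have take_z j : (j <= size s)%N -> commute z (\prod_(l <- take j s) g l).
  rewrite leq_eqVlt => /orP [/eqP->|js]; first by rewrite take_size.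
  have zj := cyc js; rewrite /rot big_cat /= -/z in zj.
  have def_z : z = \prod_(l <- take j s) g l * \prod_(l <- drop j s) g l.
    by rewrite -big_cat cat_take_drop.
  by rewrite /commute {2}zj def_z mulgA.
move=> si; have js : (index i s < size s)%N by rewrite index_mem.
have := take_z _ js; rewrite (take_nth i) // nth_index // -cats1 big_cat big_seq1 /=.
have := take_z _ (ltnW js); set a := \prod_(_ <- _) _ => za zai.
by rewrite -[g i](mulKg a); apply: commuteM => //; exact: commuteV.
Qed.

(** If the product is [a * g i * b], solve for [g i] and use centrality. *)
Lemma cyclic_product_factor i : uniq s -> i \in s ->
  exists2 x, gen_subgroup (fun y => exists2 j, (j \in s) && (j != i) & y = g j) x
    & g i = x * \prod_(j <- s) g j.
Proof.
move=> us si.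
pose K := gen_subgroup (fun y => exists2 j, (j \in s) && (j != i) & y = g j).
have zC := cyclic_product_central.
have prodK s' : {subset s' <= s} -> i \notin s' -> K (\prod_(j <- s') g j).
  move=> ss' is'; rewrite big_seq.
  apply: (big_rec K) => [|j x js' Kx]; first exact: gen_one.
  apply: gen_mul Kx; apply: gen_mem; exists j => //; rewrite ss' //=.
  by apply: contraNneq is' => <-.
have prodC s' : {subset s' <= s} -> commute (\prod_(j <- s) g j) (\prod_(j <- s') g j).
  move=> ss'; rewrite [X in commute _ X]big_seq.
  apply: (big_rec (commute _)) => [|j x js' zx].
    exact: commute1.
  by apply: commuteM zx; apply/zC/ss'.
pose s1 := take (index i s) s; pose s2 := drop (index i s).+1 s.
have def_s : s = s1 ++ i :: s2 by rewrite -drop_index // cat_take_drop.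
have s1s : {subset s1 <= s} by move=> j js1; rewrite def_s mem_cat js1.
have s2s : {subset s2 <= s} by move=> j js2; rewrite def_s mem_cat inE js2 !orbT.
have [is1 is2] : i \notin s1 /\ i \notin s2.
  by move: us; rewrite def_s cat_uniq /= negb_or => /and3P [_ /andP [is1 _] /andP []].
exists ((\prod_(j <- s1) g j)^-1 * (\prod_(j <- s2) g j)^-1).
  by apply: gen_mul; apply: gen_inv; apply: prodK.
have /commuteV c2 := prodC s2 s2s.
rewrite -mulgA; apply: esym; rewrite -c2.
by rewrite {1}def_s big_cat big_cons /= !mulgA mulVg mul1g mulgK.
Qed.
End Center.

End CyclicRelations.

(** * Retractions onto free groups *)

Section Blocks.
Local Open Scope group_scope.
Local Open Scope classical_set_scope.

Lemma bijective_morph (F H : groupType) (f : {multiplicative F -> H}) :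
  bijective f -> exists (f1 : UMagmaMorphism.type F H)
                        (f2 : UMagmaMorphism.type H F),
    cancel f1 f2 /\ cancel f2 f1.
Proof.
have morph1 (A B : groupType) (u : A -> B) :
    {morph u : x y / x * y} -> monoid_morphism u.
  by move=> uM; split=> //; apply: (mulgI (u 1)); rewrite -uM !mulg1.
case=> f' fK f'K; have fM : {morph f : x y / x * y} by exact: gmulfM.
have f'M := can2_gmulfM fK f'K.
pose f1 : UMagmaMorphism.type F H :=
  HB.pack (f : F -> H) (isUMagmaMorphism.Build F H f (morph1 _ _ _ fM)).
pose f2 : UMagmaMorphism.type H F :=
  HB.pack f' (isUMagmaMorphism.Build H F f' (morph1 _ _ _ f'M)).
by exists f1, f2.
Qed.

Lemma gen_subgroup_morph (F H : groupType) (f : UMagmaMorphism.type F H)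
    (S : set F) (S' : set H) :
  (forall s, S s -> S' (f s)) ->
  forall x, gen_subgroup S x -> gen_subgroup S' (f x).
Proof.
move=> SS' x; elim=> {x} [x /SS'||x y _ Hx _ Hy|x _ Hx].
- exact: gen_mem.
- by rewrite gmulf1; exact: gen_one.
- by rewrite gmulfM; exact: gen_mul.
- by rewrite gmulfV; exact: gen_inv.
Qed.

(** The presentation, transported from [presented] to [G] itself: the generators
    satisfy the cyclic relations, and [G] is universal for this property. *)
Lemma cf_presentation_universal (G : groupType) (P : cf_presentation G) :
  exists g : 'I_(cf_gens P) -> G,
  [/\ forall x, gen_subgroup (range g) x,
      forall p, cyclic_products_agree g (rev (cf_idx P p))
    & forall (H : groupType) (h : 'I_(cf_gens P) -> H),
        (forall p, cyclic_products_agree h (rev (cf_idx P p))) ->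
        exists f : UMagmaMorphism.type G H, forall i, f (g i) = h i].
Proof.
have [_ /bijective_morph [f [f' [fK f'K]]]] := cf_iso P.
pose rels (u v : word (cf_gens P)) := exists p, cyclic_rel (cf_idx P p) u v.
rewrite -/rels in f f' fK f'K.
pose g i := f (pgen rels i); exists g.
have f'g i : f' (g i) = pgen rels i by rewrite /g fK.
have f'_inj := can_inj f'K.
split.
- move=> x; rewrite -[x]f'K; move: (f' x) (pgen_gen (f' x)).
  by apply: gen_subgroup_morph => _ [i _ <-]; exists i.
- move=> p; apply/cyclic_relP => u v uv; apply: f'_inj.
  rewrite !word_value_morph.
  have -> : f' \o g = pgen rels by apply/funext.
  rewrite !word_value_pgen; apply/eqP/presented_eqP/wc_rel.
  by exists p.
- move=> H h hP.
  have [u v [p uv]|F Fh] := @presented_lift _ rels H h.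
    by move/cyclic_relP: (hP p); apply.
  have Ff_morph : monoid_morphism (F \o f').
    by split=> [|x y] /=; rewrite ?gmulf1 ?gmulfM.
  pose Ff : UMagmaMorphism.type G H :=
    HB.pack (F \o f') (isUMagmaMorphism.Build G H (F \o f') Ff_morph).
  by exists Ff => i; rewrite /= f'g.
Qed.

(** The free generators are the elements of [s] but the last one, whose image
    under the retraction is forced by the condition that the product over
    [rev s] be 1. *)
Lemma block_retraction (G : groupType) n m (g : 'I_n -> G) (s : seq 'I_n) :
    uniq s -> size s = m.+1 ->
    (forall h : 'I_n -> free_group m,
       \prod_(i <- rev s) h i = 1 -> (forall i, i \notin s -> h i = 1) ->
     exists f : UMagmaMorphism.type G (free_group m), forall i, f (g i) = h i) ->
  exists (inj : UMagmaMorphism.type (free_group m) G)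
         (proj : UMagmaMorphism.type G (free_group m)),
  [/\ cancel inj proj,
      forall i, i \notin s -> proj (g i) = 1,
      forall y, gen_subgroup (fun x => exists2 i, i \in s & x = g i) (inj y)
    & exists2 a, a \in s &
      gen_subgroup (fun x => exists2 i, (i \in s) && (i != a) & x = g i)
        `<=` range inj].
Proof.
move=> us size_s lift.
have [d sd] : exists d, d \in s.
  by case: s size_s {us lift} => // d s _; exists d; rewrite mem_head.
pose x_ : 'I_m -> free_group m := @pgen m (fun _ _ => False).
have x_gen y : gen_subgroup (range x_) y by exact: pgen_gen.
have lt_s (j : 'I_m) : (j < size s)%N by rewrite size_s ltnS ltnW.
have [inj injE] : exists inj : UMagmaMorphism.type (free_group m) G,
    forall j, inj (x_ j) = g (nth d s j) by exact: presented_lift.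
pose D := \prod_(j <- rev (enum 'I_m)) x_ j.
(* [insub] fails exactly at the last position of [s], the one out of ['I_m]. *)
pose h i := if i \in s then oapp x_ D^-1 (insub (index i s)) else 1.
have h_nth (j : 'I_m) : h (nth d s j) = x_ j.
  by rewrite /h mem_nth // index_uniq // valK.
have h_map : [seq h i | i <- s] = rcons (map x_ (enum 'I_m)) D^-1.
  have size_x : size (map x_ (enum 'I_m)) = m by rewrite size_map size_enum_ord.
  apply: (@eq_from_nth _ 1) => [|j]; first by rewrite size_rcons size_x size_map.
  rewrite size_map size_s => jm; rewrite (nth_map d) ?size_s // nth_rcons size_x.
  move: jm; rewrite ltnS leq_eqVlt => /orP [/eqP ->|jm].
    by rewrite ltnn eqxx /h mem_nth ?size_s // index_uniq ?size_s // insubF ?ltnn.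
  by rewrite jm (h_nth (Ordinal jm)) (nth_map (Ordinal jm)) ?size_enum_ord //
    (nth_ord_enum _ (Ordinal jm)).
have h_prod : \prod_(i <- rev s) h i = 1.
  rewrite -(big_map h xpredT id) map_rev h_map rev_rcons big_cons -map_rev big_map.
  exact: mulVg.
have [proj projE] :
    exists f : UMagmaMorphism.type G (free_group m), forall i, f (g i) = h i.
  by apply: lift => // i /negPf is'; rewrite /h is'.
exists inj, proj; split.
- move=> y; move: y (x_gen y); apply: gen_subgroup_min => [|_ [j _ <-]].
    split=> [|u v Hu Hv|u Hu]; rewrite ?gmulf1 ?gmulfM ?gmulfV ?Hu ?Hv //.
  by rewrite injE projE h_nth.
- by move=> i /negPf is'; rewrite projE /h is'.
- move=> y; move: y (x_gen y); apply: gen_subgroup_morph => _ [j _ <-].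
  by rewrite injE; exists (nth d s j); rewrite ?mem_nth.
exists (nth d s m); first by rewrite mem_nth ?size_s.
apply: gen_subgroup_min => [|_ [i /andP [si im] ->]].
  by apply: morph_is_subgroup.
have lt_i : (index i s < m)%N.
  have := si; rewrite -index_mem size_s ltnS leq_eqVlt => /orP [/eqP i_m|//].
  by case/eqP: im; rewrite -i_m nth_index.
by exists (x_ (Ordinal lt_i)) => //; rewrite injE nth_index.
Qed.

End Blocks.

(** * Blocks of a conjugation-free presentation *)

Lemma adjacent_triangles_eq (T : finType) (e : rel T) (p q r s : T) :
    symmetric e -> irreflexive e -> cycles_disjoint e ->
    e p q -> e q r -> e p r -> e r s -> e p s -> s = q.
Proof.
move=> e_sym e_irr disj pq qr pr rs ps.
have neq x y : e x y -> x != y by apply: contraTneq => ->; rewrite e_irr.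
have triangle x y z : e x y -> e y z -> e x z -> graph_cycle e [:: x; y; z].
  move=> xy yz xz; split=> //; rewrite /ucycle /= xy yz e_sym xz /=.
  by rewrite !inE negb_or !neq.
apply/eqP/negPn/negP => sq.
have cpqr := triangle _ _ _ pq qr pr; have cprs := triangle _ _ _ pr rs ps.
suff /(disj _ _ cpqr cprs) :
    cycle_edges [:: p; q; r] != cycle_edges [:: p; r; s].
  by move=> /pred0P/(_ p); rewrite /= !inE eqxx.
(* The edge pq lies on the first triangle, and q is no vertex of the second. *)
apply/eqP => /setP/(_ [set p; q]%SET).
have -> : [set p; q]%SET \in cycle_edges [:: p; q; r].
  by apply/imsetP; exists p; rewrite ?inE /= eqxx.
move/esym/imsetP => [x xprs] /setP/(_ q).
rewrite !inE eqxx orbT => /esym/orP qx.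
have qprs : q \in [:: p; r; s].
  by case: qx => /eqP -> //; rewrite mem_next.
move: qprs; rewrite !inE eq_sym (negPf (neq _ _ pq)) (negPf (neq _ _ qr)).
by rewrite eq_sym (negPf sq).
Qed.

Section Decomposition.
Import GRing.Theory.
Local Open Scope group_scope.
Local Open Scope classical_set_scope.
Variables (G : groupType) (P : cf_presentation G).

Definition block (p : gr_vertex P) : {set 'I_(cf_gens P)} :=
  [set i in cf_idx P (val p)]%SET.

Lemma cf_idx_uniq p : uniq (cf_idx P p).
Proof.
apply: (sorted_uniq _ _ (cf_sorted p)) => [x y z|x]; first exact: ltn_trans.
exact: ltnn.
Qed.

Lemma cf_idx_meet p q i j : p != q -> i \in cf_idx P p -> i \in cf_idx P q ->
  j \in cf_idx P p -> j \in cf_idx P q -> i = j.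
Proof.
move=> pq pi qi pj qj; apply/eqP/negPn/negP => ij.
have := cf_meet pq; rewrite leqNgt => /negP; apply.
by apply/card_gt1P; exists i, j; rewrite !inE pi pj.
Qed.

Lemma block_meet p q i j : p != q -> i \in block p -> i \in block q ->
  j \in block p -> j \in block q -> i = j.
Proof. by rewrite !inE -val_eqE; exact: cf_idx_meet. Qed.

Lemma blocks_meet_edge p q : blocks_meet block p q -> gr_edge p q.
Proof.
case/andP => pq /existsP [i /andP [pi qi]]; rewrite /gr_edge pq /=.
rewrite eqn_leq cf_meet /= ?val_eqE //.
by apply/card_gt0P; exists i; rewrite !inE in pi qi *; rewrite pi.
Qed.

Lemma block_triangles_eq p q r s :
    symmetric (@gr_edge G P) -> cycles_disjoint (@gr_edge G P) ->
    blocks_meet block p q -> blocks_meet block q r -> blocks_meet block p r ->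
    blocks_meet block r s -> blocks_meet block p s -> s = q.
Proof.
move=> e_sym e_disj /blocks_meet_edge pq /blocks_meet_edge qr.
move=> /blocks_meet_edge pr /blocks_meet_edge rs /blocks_meet_edge ps.
apply: (adjacent_triangles_eq e_sym _ e_disj pq qr pr rs ps) => p'.
by rewrite /gr_edge eqxx.
Qed.

Section Generators.
Variable g : 'I_(cf_gens P) -> G.
Hypothesis g_rel : forall p, cyclic_products_agree g (rev (cf_idx P p)).

Lemma unlinked_generators_commute i j :
  ~~ linked block i j -> commute (g i) (g j).
Proof.
move=> /existsPn nl; have [-> //|ij] := eqVneq i j.
have [p [/andP [pi pj] _]] := cf_pair ij.
have s2 : size (cf_idx P p) = 2%N.
  apply/eqP; rewrite eqn_leq cf_size andbT leqNgt; apply/negP => s3.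
  by have := nl (Sub p s3); rewrite !inE pi pj.
have := @g_rel p 1%N; rewrite size_rev s2 => /(_ isT).
have {s2} := s2; case: (cf_idx P p) pi pj => [|x [|y []]] //= + + _.
rewrite /rev /= /rot /= !big_cons !big_nil !mulg1 !inE.
by move=> /orP [] /eqP ix /orP [] /eqP jx; subst i j; rewrite ?eqxx // in ij *.
Qed.

Lemma block_central_product p : exists z : G,
  (forall i, i \in block p -> commute z (g i)) /\
  (forall i, i \in block p ->
     exists2 x, punctured_subgroup g block p i x & g i = x * z).
Proof.
exists (\prod_(j <- rev (cf_idx P (val p))) g j); split=> i; rewrite inE => pi.
  by apply: cyclic_product_central => //; rewrite mem_rev.
have [||x Kx gi] := cyclic_product_factor (@g_rel (val p)) (i := i).
- by rewrite rev_uniq cf_idx_uniq.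
- by rewrite mem_rev.
exists x => //; move: x Kx {gi}.
apply: gen_subgroupS => _ [j /andP [pj ji] ->].
by exists j => //; rewrite inE -mem_rev pj.
Qed.

Lemma block_free_retraction p :
    (forall (H : groupType) (h : 'I_(cf_gens P) -> H),
       (forall q, cyclic_products_agree h (rev (cf_idx P q))) ->
     exists f : UMagmaMorphism.type G H, forall i, f (g i) = h i) ->
  exists (inj : UMagmaMorphism.type
                  (free_group (size (cf_idx P (val p)) - 1)) G)
         (proj : UMagmaMorphism.type
                  G (free_group (size (cf_idx P (val p)) - 1))),
  [/\ cancel inj proj,
      forall i, i \notin block p -> proj (g i) = 1,
      forall y, block_subgroup g block p (inj y)
    & exists2 a, a \in block p & punctured_subgroup g block p a `<=` range inj].
Proof.
move=> g_univ; set m := (size _ - 1)%N.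
have size_m : size (cf_idx P (val p)) = m.+1.
  by rewrite /m subn1 prednK // (leq_trans _ (valP p)).
have [h h_prod h_out|inj [proj [injK out inj_block [a pa pun]]]] :=
    @block_retraction G _ m g _ (cf_idx_uniq (val p)) size_m.
  apply: g_univ => q; have [->|qp] := eqVneq q (val p).
    exact: cyclic_products_agree1.
  apply: cyclic_products_agree_meet1 => [|i j].
    by rewrite rev_uniq cf_idx_uniq.
  rewrite !mem_rev => qi qj hi hj; apply: (cf_idx_meet qp) => //.
    by apply: contraNT hi => /h_out ->.
  by apply: contraNT hj => /h_out ->.
exists inj, proj; split=> //= [i|y|].
- by rewrite inE; exact: out.
- move: (inj_block y); apply: gen_subgroupS => _ [i pi ->].
  by exists i; rewrite ?inE.
- exists a; rewrite ?inE //; apply: subset_trans pun.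
  by apply: gen_subgroupS => _ [i + ->]; rewrite inE => pi; exists i.
Qed.
End Generators.

(** The homomorphisms [F -> G -> F] of [block_free_retraction] induce maps on
    the k-th quotients that present [lcq G k] as a direct sum: for two different
    blocks the composite has abelian image, since the blocks share at most one
    generator, and so kills [lcs 2]; and [lcs_blocks] shows that the summands
    fill the whole quotient. *)
Lemma phi_sum_blocks k :
    symmetric (@gr_edge G P) -> cycles_disjoint (@gr_edge G P) -> (2 <= k)%N ->
  phi G k = (\sum_(p : gr_vertex P) omega k (size (cf_idx P (val p)) - 1))%N.
Proof.
move=> e_sym e_disj k2.
have [g [g_gen g_rel g_univ]] := cf_presentation_universal P.
have center := block_central_product g_rel.
pose m (p : gr_vertex P) := (size (cf_idx P (val p)) - 1)%N.
pose fam (p : gr_vertex P) :=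
    fun r : UMagmaMorphism.type (free_group (m p)) G *
            UMagmaMorphism.type G (free_group (m p)) =>
  [/\ cancel r.1 r.2,
      forall i, i \notin block p -> r.2 (g i) = 1,
      forall y, block_subgroup g block p (r.1 y)
    & exists2 a, a \in block p &
        punctured_subgroup g block p a `<=` range r.1].
have /all_sig [r r_fam] p : {r | fam p r}.
  apply: cid; have [inj [proj H]] := block_free_retraction p g_univ.
  by exists (inj, proj).
rewrite /phi (rank_direct_sum (B := fun p => lcq (free_group (m p)) k)
  (inj := fun p => @lcq_map _ _ (r p).1 k : {additive _ -> _})
  (proj := fun p => @lcq_map _ _ (r p).2 k : {additive _ -> _})) //.
- move=> p; case: k k2 => // k' _.
  apply: (lcq_zspans (gens := codom (@pgen (m p) _))) => x.
  by move: (pgen_gen x); apply: gen_subgroupS => _ [i _ <-]; exact: codom_f.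
- move=> p b; have [x kx ->] := lcq_class_surj b; have [rK _ _ _] := r_fam p.
  by rewrite /= !lcq_map_class ?rK //; exact: lcs_morph.
- move=> p q b pq; have [x kx ->] := lcq_class_surj b.
  have [_ _ inj_block _] := r_fam p; have [_ out _ _] := r_fam q.
  rewrite /= !lcq_map_class //; last exact: lcs_morph.
  suff -> : (r q).2 ((r p).1 x) = 1 by rewrite lcq_class0 //; exact: lcs1.
  have comm_block u v : block_subgroup g block p u ->
      block_subgroup g block p v -> commute ((r q).2 u) ((r q).2 v).
    move=> pu pv.
    pose S := (fun i => (r q).2 (g i)) @` [set i | i \in block p].
    have qS w : block_subgroup g block p w -> gen_subgroup S ((r q).2 w).
      by apply: gen_subgroup_morph => _ [i pi ->]; exists i.
    apply: (@gen_subgroup_commute _ S S); [|exact: qS..].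
    move=> _ _ [i /= pi <-] [j /= pj <-].
    have [qi|/out ->] := boolP (i \in block q); last exact/commute_sym/commute1.
    have [qj|/out ->] := boolP (j \in block q); last exact/commute1.
    by rewrite (block_meet (i := i) (j := j) pq).
  have := lcs_le k2 kx; move: x {kx}.
  apply: gen_subgroup_min => [|_ [u [v [_ _ ->]]]].
    split=> [|u v|u]; rewrite ?gmulf1 // => Hu.
      by rewrite !gmulfM Hu mul1g.
    by rewrite !gmulfV Hu invg1.
  by rewrite !gmulfR; apply/eqP/commgP/comm_block; exact: inj_block.
move=> a; have [x kx ->] := lcq_class_surj a.
suff [_ //] : lcs k x /\ exists b : forall p, lcq (free_group (m p)) k,
    lcq_class k x = (\sum_p lcq_map (r p).1 (b p))%R.
have := lcs_blocks g_gen (unlinked_generators_commute g_rel) center block_meet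
  (fun _ _ _ _ => block_triangles_eq e_sym e_disj) k2 kx.
move: x {kx}; apply: gen_subgroup_min.
  split=> [|x y [kx [c xc]] [ky [d yd]]|x [kx [c xc]]].
  - split; first exact: lcs1.
    exists (fun=> 0%R); rewrite (lcq_class0 (@lcs1 _ _) (@lcs1 _ _)) big1 // => p _.
    exact: raddf0.
  - split; first exact: lcsM.
    exists (fun i => c i + d i)%R; rewrite lcq_classM // xc yd -big_split /=.
    by apply: eq_bigr => i _; rewrite raddfD.
  - split; first exact: lcsV.
    exists (fun i => - c i)%R; rewrite lcq_classV // xc -sumrN.
    by apply: eq_bigr => i _; rewrite raddfN.
move=> x [p px]; have [_ _ _ [e pe pun]] := r_fam p.
have [y ky <-] : ((r p).1 @` lcs k) x.
  apply: sub_lcs_range; apply: (sub_lcsS pun).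
  exact: (sub_lcs_block_punctured center pe k2).
split; first exact: lcs_morph.
exists (dfwith (fun q => 0%R : lcq (free_group (m q)) k) (lcq_class k y)).
rewrite (bigD1 p) //= dfwith_in lcq_map_class // big1 ?addr0 // => q qp.
by rewrite dfwith_out 1?eq_sym // raddf0.
Qed.

Lemma sum_over_multiple_relations (F : nat -> nat) :
  (\sum_(p : gr_vertex P) F (size (cf_idx P (val p))) =
   \sum_(3 <= i < (cf_gens P).+1) cf_count P i * F i)%N.
Proof.
transitivity (\sum_(p | (3 <= size (cf_idx P p))%N) F (size (cf_idx P p)))%N.
  rewrite (reindex_omap (val : gr_vertex P -> _) insub) /= => [|p p3].
    by apply: eq_bigl => p; rewrite valK eqxx andbT (valP p).
  by rewrite insubT.
transitivity (\sum_(3 <= i < (cf_gens P).+1)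
    \sum_p if size (cf_idx P p) == i then F i else 0)%N; last first.
  by apply: eq_bigr => i _; rewrite -big_mkcond sum_nat_cond_const.
rewrite exchange_big big_mkcond; apply: eq_bigr => p _ /=.
rewrite -big_mkcond /=; under eq_bigl do rewrite eq_sym.
rewrite big_nat1_eq ltnS (_ : (size _ <= _)%N) ?andbT //.
by rewrite -(card_uniqP (cf_idx_uniq p)) (leq_trans (max_card _)) ?card_ord.
Qed.

End Decomposition.

Theorem theorem4p18 (R : realType) (G : groupType) (P : cf_presentation G)
    (hP : cycle_separated R (@gr_edge G P)) (k : nat) (hk : 2 <= k) :
  phi G k = \sum_(3 <= i < (cf_gens P).+1) cf_count P i * omega k (i - 1).
Proof.
have [[e_sym _] _ e_disj _] := hP.
rewrite (phi_sum_blocks e_sym e_disj hk).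
exact: (sum_over_multiple_relations P (fun i => omega k (i - 1))).
Qed.
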